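(* Let $A$ be an $n\times n$ complex matrix with real eigenvalues $\lambda_i$, $i=1,2,\dots,n$. Then $$\lambda_{\max}\ge\frac{\operatorname{tr}A}{n}+\frac{\operatorname{tr}B^2}{n}\left(\frac{1+(n-1)^{2r-1}}{(n-1)^{2r-1}}\,\frac{1}{\operatorname{tr}B^{2r}}\right)^{\frac{1}{2r}}$$ and $$\lambda_{\min}\le\frac{\operatorname{tr}A}{n}-\frac{\operatorname{tr}B^2}{n}\left(\frac{1+(n-1)^{2r-1}}{(n-1)^{2r-1}}\,\frac{1}{\operatorname{tr}B^{2r}}\right)^{\frac{1}{2r}},$$ where $B=A-\frac{\operatorname{tr}A}{n}I$.
   Context: Here $\operatorname{tr}$ denotes the trace, $I$ is the $n\times n$ identity matrix, $\lambda_{\max}$ and $\lambda_{\min}$ are the largest and smallest eigenvalues of $A$, and $r=1,2,\dots$ is a positive integer. *)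

(* Defs.v *)
From mathcomp Require Import all_boot all_order all_algebra.
From mathcomp Require Import reals.
From mathcomp Require Export complex.

Set Implicit Arguments.
Unset Strict Implicit.
Unset Printing Implicit Defensive.

Import Order.TTheory GRing.Theory Num.Theory.
Local Open Scope ring_scope.

(* The order on R[i] is partial: x <= y means that y - x is a nonnegative    *)
(* real.  Between real numbers this is the usual order of R.                 *)

Definition real_eigenvalues (R : realType) (n : nat) (A : 'M[R[i]]_n) : Prop :=
  forall z : R[i], eigenvalue A z -> z \is Num.real.

Definition largest_eigenvalue (R : realType) (n : nat) (A : 'M[R[i]]_n)
    (l : R[i]) : Prop :=
  eigenvalue A l /\ forall z : R[i], eigenvalue A z -> z <= l.

Definition smallest_eigenvalue (R : realType) (n : nat) (A : 'M[R[i]]_n)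
    (l : R[i]) : Prop :=
  eigenvalue A l /\ forall z : R[i], eigenvalue A z -> l <= z.

(* Main.v *)
Require Import Defs.
From mathcomp Require Import all_boot all_order all_algebra.
From mathcomp Require Import ring.
From mathcomp Require Import reals complex.

Set Implicit Arguments.
Unset Strict Implicit.
Unset Printing Implicit Defensive.

Import Order.TTheory GRing.Theory Num.Theory.
Local Open Scope ring_scope.

(** Why the bound holds.  Let [x_i] be the eigenvalues of [B], that is, those
    of [A] shifted by their mean, so that [\sum_i x_i = 0], and put
    [M = max x_i], [m = - min x_i].  Write [S_k = \sum_i x_i ^+ k = \tr (B ^+ k)].
    Unless all [x_i] vanish, which makes both bounds trivial, [n >= 2] and
    [m > 0].  Two inequalities are combined.
    - Each product [(M - x_i) * (x_i + m)] is nonnegative; summing them, the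
      linear terms cancel and [S_2 <= n * m * M] ([sum_sqr_le]).
    - One of the [x_i] is [- m], so the other [n - 1] sum to [m]; by convexity
      of the power [2r] they contribute at least [m ^+ 2r / (n - 1) ^+ (2r - 1)]
      to [S_2r], so [S_2r >= m ^+ 2r * q] with
      [q = 1 + 1 / (n - 1) ^+ (2r - 1)] ([sum_even_pow_ge]).
    The second one says that the [2r]-th root of [q / S_2r] is at most [1 / m],
    and then the first one gives [S_2 / n * root <= S_2 / (n * m) <= M].
    This is the bound on the largest eigenvalue; the bound on the smallest one
    is the same statement for the numbers [- x_i].

    The passage from matrices to numbers is Schur triangularization
    ([trig_spectrum]): the diagonal of a triangular matrix similar to [A] lists
    the eigenvalues, and the traces of powers of [A - c] are the power sums of
    this diagonal shifted by [c]. *)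

(** * Inequalities for real numbers with sum zero *)

(** The inductive step multiplies by [y] and adds the nonnegative
    [(k + 1) * a ^+ k * (y - a) ^+ 2]. *)
Lemma ge0_tangent_pow_le (F : numDomainType) (a y : F) (k : nat) :
  0 <= a -> 0 <= y -> a ^+ k.+1 + k.+1%:R * a ^+ k * (y - a) <= y ^+ k.+1.
Proof.
move=> a0 y0; elim: k => [|k IHk].
  by rewrite !expr1 expr0 !mul1r addrC subrK.
rewrite -subr_ge0 in IHk; rewrite -subr_ge0.
rewrite [X in 0 <= X](_ : _ =
    y * (y ^+ k.+1 - (a ^+ k.+1 + k.+1%:R * a ^+ k * (y - a)))
    + k.+1%:R * a ^+ k * (y - a) ^+ 2); last by rewrite !exprS; ring.
have sqr_ge0 : 0 <= (y - a) ^+ 2.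
  by rewrite real_exprn_even_ge0 ?rpredB ?ger0_real.
by apply: addr_ge0; rewrite mulr_ge0 // mulr_ge0 ?exprn_ge0 ?ler0n.
Qed.

(** For negative [y] the tangent at [a] is already nonpositive. *)
Lemma tangent_even_pow_le (F : numDomainType) (a y : F) (k : nat) :
    odd k -> 0 <= a -> y \is Num.real ->
  a ^+ k.+1 + k.+1%:R * a ^+ k * (y - a) <= y ^+ k.+1.
Proof.
move=> k_odd a0 y_real; have [y0|y0] := real_ge0P y_real.
  exact: ge0_tangent_pow_le.
apply: (@le_trans _ _ 0); last by rewrite real_exprn_even_ge0 //= k_odd.
rewrite [X in X <= _](_ : _ = - (k%:R * a ^+ k.+1 + k.+1%:R * a ^+ k * - y)).
  rewrite oppr_le0; apply: addr_ge0.
    by rewrite mulr_ge0 ?exprn_ge0 ?ler0n.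
  by rewrite !mulr_ge0 ?exprn_ge0 ?ler0n // oppr_ge0 ltW.
by rewrite !exprS -[k.+1]addn1 natrD; ring.
Qed.

(** The tangent at the mean [a], summed. *)
Lemma even_power_mean (F : numDomainType) (I : finType) (P : pred I)
    (x : I -> F) (a : F) (k : nat) :
    odd k -> 0 <= a -> (forall i, x i \is Num.real) ->
    \sum_(i in P) x i = #|P|%:R * a ->
  #|P|%:R * a ^+ k.+1 <= \sum_(i in P) x i ^+ k.+1.
Proof.
move=> k_odd a0 x_real sum_x.
rewrite [X in X <= _](_ : _ = \sum_(i in P)
    (a ^+ k.+1 + k.+1%:R * a ^+ k * (x i - a))).
  by apply: ler_sum => i _; apply: tangent_even_pow_le.
rewrite big_split -mulr_sumr sumrB !sumr_const sum_x /=.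
by rewrite !(mulr_natl _ #|P|) subrr mulr0 addr0.
Qed.

Lemma sum_sqr_le (F : numDomainType) (n : nat) (x : 'I_n -> F) (m M : F) :
    \sum_i x i = 0 -> (forall i, - m <= x i) -> (forall i, x i <= M) ->
  \sum_i x i ^+ 2 <= n%:R * m * M.
Proof.
move=> sum_x x_ge x_le; rewrite -subr_ge0.
rewrite [X in 0 <= X](_ : _ = \sum_i (M - x i) * (x i + m)).
  apply: sumr_ge0 => i _; rewrite mulr_ge0 ?subr_ge0 //.
  by rewrite -[m]opprK subr_ge0.
rewrite [RHS](eq_bigr (fun i => m * M + (M - m) * x i - x i ^+ 2)); last first.
  by move=> i _; ring.
rewrite sumrB big_split /= sumr_const card_ord -mulr_sumr sum_x mulr0 addr0.
by rewrite -[m * M *+ n]mulr_natl mulrA.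
Qed.

(** The [n - 1] numbers other than [x j] have sum [m], hence mean
    [m / (n - 1)]; the power mean inequality bounds their contribution and
    [x j] itself adds [m ^+ k.+1]. *)
Lemma sum_even_pow_ge (F : numFieldType) (n k : nat) (x : 'I_n -> F) (j : 'I_n)
    (m : F) :
    odd k -> (1 < n)%N -> 0 <= m -> (forall i, x i \is Num.real) ->
    \sum_i x i = 0 -> x j = - m ->
  m ^+ k.+1 * ((1 + (n%:R - 1) ^+ k) / (n%:R - 1) ^+ k)
  <= \sum_i x i ^+ k.+1.
Proof.
move=> k_odd n_gt1 m0 x_real sum_x xj.
have N_gt0 : 0 < n%:R - 1 :> F by rewrite subr_gt0 ltr1n.
set N := n%:R - 1 in N_gt0 *.
have cardN : #|predC1 j|%:R = N.
  by rewrite cardC1 card_ord /N -[in RHS](prednK (ltnW n_gt1)) -natr1 addrK.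
have sum_others : \sum_(i in predC1 j) x i = #|predC1 j|%:R * (m / N).
  rewrite cardN mulrC divfK ?gt_eqF //.
  move: sum_x; rewrite (bigD1 j) //= xj => /eqP.
  by rewrite addrC subr_eq0 => /eqP.
have := even_power_mean k_odd (divr_ge0 m0 (ltW N_gt0)) x_real sum_others.
rewrite cardN => mean; rewrite (bigD1 j) //= xj.
have -> : (- m) ^+ k.+1 = m ^+ k.+1 by rewrite exprNn -signr_odd /= k_odd mul1r.
rewrite [X in X <= _](_ : _ = m ^+ k.+1 + N * (m / N) ^+ k.+1).
  by rewrite lerD2l.
rewrite expr_div_n [N ^+ k.+1]exprS.
by field; rewrite expf_neq0 gt_eqF.
Qed.

(** The two inequalities combined.  If [n = 1] or [\sum_i x i ^+ k.+1 = 0] then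
    every [x i] is [0]; so as soon as [x j < 0] all the denominators are
    positive, and if [x j = 0] the left-hand side is [0] because its first
    factor is. *)
Lemma sum0_max_ge (C : numClosedFieldType) (n k : nat) (x : 'I_n -> C)
    (j : 'I_n) (M : C) :
    odd k -> (forall i, x i \is Num.real) -> \sum_i x i = 0 ->
    (forall i, x j <= x i) -> (forall i, x i <= M) ->
  (\sum_i x i ^+ 2) / n%:R
    * k.+1.-root ((1 + (n%:R - 1) ^+ k) / (n%:R - 1) ^+ k
                  * (1 / \sum_i x i ^+ k.+1)) <= M.
Proof.
move=> k_odd x_real sum_x x_ge x_le.
have n_gt0 : (0 < n)%N by rewrite (leq_trans _ (ltn_ord j)).
have sum_cst (c : C) : \sum_(i < n) c = c *+ n by rewrite sumr_const card_ord.
have M0 : 0 <= M.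
  by rewrite -(pmulrn_lge0 M n_gt0) -sum_cst -[leLHS]sum_x ler_sum.
have m0 : 0 <= - x j.
  by rewrite oppr_ge0 -(pmulrn_lle0 (x j) n_gt0) -sum_cst -[leRHS]sum_x ler_sum.
have S2_le : \sum_i x i ^+ 2 <= n%:R * - x j * M.
  by apply: sum_sqr_le => // i; rewrite opprK.
have S2_ge0 : 0 <= \sum_i x i ^+ 2.
  by apply: sumr_ge0 => i _; rewrite real_exprn_even_ge0.
have [xj0|xj_neq0] := eqVneq (x j) 0.
  have -> : \sum_i x i ^+ 2 = 0.
    by apply/eqP; rewrite eq_le S2_ge0 andbT (le_trans S2_le) // xj0 oppr0
      mulr0 mul0r.
  by rewrite !mul0r.
have m_gt0 : 0 < - x j by rewrite lt_def oppr_eq0 xj_neq0.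
have n_gt1 : (1 < n)%N.
  rewrite ltnNge; apply: contra xj_neq0 => n_le1; apply/eqP.
  rewrite -sum_x (bigD1 j) //= big1 ?addr0 // => i /negP[].
  have := leq_trans (ltn_ord i) n_le1; have := leq_trans (ltn_ord j) n_le1.
  by rewrite -val_eqE /= !ltnS !leqn0 => /eqP-> /eqP->.
set q := (1 + _) / _; set S2 := \sum_i x i ^+ 2 in S2_le S2_ge0 *.
set S := \sum_i x i ^+ k.+1.
have N_gt0 : 0 < n%:R - 1 :> C by rewrite subr_gt0 ltr1n.
have q_gt0 : 0 < q by rewrite divr_gt0 ?addr_gt0 ?exprn_gt0.
have S_ge : (- x j) ^+ k.+1 * q <= S.
  by apply: sum_even_pow_ge => //; rewrite opprK.
have S_gt0 : 0 < S by apply: lt_le_trans S_ge; rewrite mulr_gt0 ?exprn_gt0.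
have root_le : k.+1.-root (q * (1 / S)) <= (- x j)^-1.
  rewrite -[leRHS](@exprCK _ k.+1) ?invr_ge0 //.
  rewrite ler_rootC ?nnegrE ?exprn_ge0 ?invr_ge0 //; last first.
    by rewrite mul1r divr_ge0 // ltW.
  by rewrite mul1r ler_pdivrMr // exprVn mulrC ler_pdivlMr ?exprn_gt0 // mulrC.
apply: (@le_trans _ _ (S2 / n%:R * (- x j)^-1)).
  by rewrite ler_wpM2l // divr_ge0 ?ler0n.
by rewrite ler_pdivrMr // ler_pdivrMr ?ltr0n // mulrC mulrA mulrAC.
Qed.

(** * Eigenvalues and traces of powers *)

Lemma trig_mulmx (R : pzRingType) (n : nat) (T U : 'M[R]_n) :
    is_trig_mx T -> is_trig_mx U ->
  is_trig_mx (T *m U) /\ forall i, (T *m U) i i = T i i * U i i.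
Proof.
move=> /is_trig_mxP Ttrig /is_trig_mxP Utrig; split.
  apply/is_trig_mxP => i j lt_ij; rewrite mxE big1 // => l _.
  have [le_li|lt_il] := leqP l i; last by rewrite Ttrig ?mul0r.
  by rewrite Utrig ?mulr0 // (leq_ltn_trans le_li).
move=> i; rewrite mxE (bigD1 i) //= big1 ?addr0 // => l neq_li.
have [lt_il|lt_li|/val_inj eq_il] := ltngtP i l.
- by rewrite Ttrig ?mul0r.
- by rewrite Utrig ?mulr0.
- by rewrite eq_il eqxx in neq_li.
Qed.

Lemma trig_expmx (R : pzRingType) (n : nat) (T : 'M[R]_n) (k : nat) :
    is_trig_mx T ->
  is_trig_mx (T ^+ k) /\ forall i, (T ^+ k) i i = T i i ^+ k.
Proof.
move=> Ttrig; elim: k => [|k [IHtrig IHdiag]].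
  split; first exact: scalar_mx_is_trig.
  by move=> i; rewrite !expr0 mxE eqxx.
have [STtrig STdiag] := trig_mulmx Ttrig IHtrig.
by rewrite exprS; split=> // i; rewrite STdiag IHdiag exprS.
Qed.

Lemma similar_eigenvalue (F : fieldType) (n : nat) (P A T : 'M[F]_n) (z : F) :
  P \in unitmx -> P *m A = T *m P -> eigenvalue T z -> eigenvalue A z.
Proof.
move=> Punit PA /eigenvalueP[v vT v0]; apply/eigenvalueP; exists (v *m P).
  by rewrite -mulmxA PA mulmxA vT scalemxAl.
by apply: contraNneq v0 => vP; rewrite -[v](mulmxK Punit) vP mul0mx.
Qed.

Lemma trig_eigenvalue (F : fieldType) (n : nat) (T : 'M[F]_n) (z : F) :
  is_trig_mx T -> eigenvalue T z = [exists i, z == T i i].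
Proof.
move=> Ttrig; rewrite eigenvalue_root_char char_poly_trig //.
rewrite rootE horner_prod; apply/eqP/existsP => [/eqP/prodf_eq0[i _ Tz]|[i /eqP->]].
  by exists i; rewrite hornerXsubC subr_eq0 in Tz.
by rewrite (bigD1 i) //= hornerXsubC subrr mul0r.
Qed.

Lemma similar_mxtrace_exp (F : fieldType) (n : nat) (P A T : 'M[F]_n) (k : nat) :
  P \in unitmx -> P *m A = T *m P -> \tr (A ^+ k) = \tr (T ^+ k).
Proof.
move=> Punit PA.
have PAk : P *m A ^+ k = T ^+ k *m P.
  elim: k => [|k IHk]; first by rewrite !expr0 mulmx1 mul1mx.
  by rewrite !exprS mulmxA PA -mulmxA IHk mulmxA.
by rewrite -[A ^+ k](mulKmx Punit) PAk mxtrace_mulC mulmxK.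
Qed.

(** The numbers [x i] are the diagonal of a Schur form of [A].  The shift [c]
    comes for free, since subtracting a scalar matrix preserves both the
    similarity and the triangular shape; [c = 0] gives the traces for [A]
    itself. *)
Lemma trig_spectrum (C : numClosedFieldType) (n : nat) (A : 'M[C]_n) :
    (0 < n)%N ->
  exists2 x : 'I_n -> C,
    forall z, eigenvalue A z <-> exists i, z = x i
  & forall (c : C) (k : nat), \tr ((A - c%:M) ^+ k) = \sum_i (x i - c) ^+ k.
Proof.
move=> n_gt0; have [P /unitarymx_unit Punit Atrig] := Schur A n_gt0.
have [T Ttrig PA] : exists2 T, is_trig_mx T & P *m A = T *m P.
  by exists (conjmx P A) => //; apply/(similarP Punit)/eqP.
have P'T : invmx P *m T = A *m invmx P.
  by rewrite -[T](mulmxK Punit) -PA !mulmxA mulVmx ?mul1mx.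
exists (fun i => T i i) => [z|c k].
  split=> [Az|[i ->]].
    have : eigenvalue T z by apply: similar_eigenvalue P'T Az; rewrite unitmx_inv.
    by rewrite trig_eigenvalue // => /existsP[i /eqP->]; exists i.
  apply: similar_eigenvalue Punit PA _.
  by rewrite trig_eigenvalue //; apply/existsP; exists i.
have PAc : P *m (A - c%:M) = (T - c%:M) *m P.
  by rewrite mulmxBr mulmxBl PA scalar_mxC.
have Tctrig : is_trig_mx (T - c%:M).
  move/is_trig_mxP: Ttrig => Ttrig; apply/is_trig_mxP => i j lt_ij.
  by rewrite !mxE Ttrig // -val_eqE /= ltn_eqF // subr0.
rewrite (similar_mxtrace_exp _ Punit PAc); apply: eq_bigr => i _.
by rewrite (trig_expmx k Tctrig).2 !mxE eqxx.
Qed.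

(** * The bounds on the extreme eigenvalues *)

(* MathComp. When n = 1 or \tr (B ^+ (2 * r)) = 0, the paper's formula contains
   a division by 0; then \tr (B ^+ 2) = 0 and the correction term is 0 here. *)
Theorem theorem2p6 (R : realType) (n : nat) (A : 'M[R[i]]_n) (r : nat)
    (lmax lmin : R[i])
    (hr : (0 < r)%N)
    (hreal : real_eigenvalues A)
    (hmax : largest_eigenvalue A lmax)
    (hmin : smallest_eigenvalue A lmin) :
  let B : 'M[R[i]]_n := A - (\tr A / n%:R)%:M in
  (\tr A / n%:R
     + \tr (B ^+ 2) / n%:R
       * (2 * r)%N.-root ((1 + (n%:R - 1) ^+ (2 * r - 1)%N)
                            / (n%:R - 1) ^+ (2 * r - 1)%N
                          * (1 / \tr (B ^+ (2 * r)%N)))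
   <= lmax)
  /\
  (lmin <=
   \tr A / n%:R
     - \tr (B ^+ 2) / n%:R
       * (2 * r)%N.-root ((1 + (n%:R - 1) ^+ (2 * r - 1)%N)
                            / (n%:R - 1) ^+ (2 * r - 1)%N
                          * (1 / \tr (B ^+ (2 * r)%N)))).
Proof.
move=> B.
have [k even_r] : exists k, (2 * r)%N = k.+1.
  by exists (2 * r).-1; rewrite prednK // muln_gt0.
have odd_k : odd k.
  by rewrite -[odd k]negbK -[~~ odd k]/(odd k.+1) -even_r mul2n odd_double.
have n_gt0 : (0 < n)%N.
  case: n A hmax {hreal hmin B} => // A [/eigenvalueP[v _ /eqP v0] _].
  by case: v0; apply: thinmx0.
have [y eigA trA] := trig_spectrum A n_gt0.
have [_ le_lmax] := hmax; have [_ ge_lmin] := hmin.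
have [/eigA[j lmaxE] /eigA[l lminE]] := (hmax.1, hmin.1).
set mu := \tr A / n%:R in B *.
have eig_y i : eigenvalue A (y i) by apply/eigA; exists i.
pose x i := y i - mu.
have sum_y : \sum_i y i = n%:R * mu.
  rewrite /mu mulrC divfK ?pnatr_eq0 -?lt0n //.
  have := trA 0 1; rewrite expr1 raddf0 subr0 => ->.
  by apply: eq_bigr => i _; rewrite subr0 expr1.
have sum_x : \sum_i x i = 0.
  by rewrite sumrB sum_y sumr_const card_ord mulr_natl subrr.
have trB e : \tr (B ^+ e) = \sum_i x i ^+ e by rewrite trA.
have mu_real : mu \is Num.real.
  have -> : mu = (\sum_i y i) / n%:R.
    by rewrite sum_y mulrC mulKf // pnatr_eq0 -lt0n.
  by rewrite rpred_div ?realn // rpred_sum // => i _; apply: hreal.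
have x_real i : x i \is Num.real by rewrite rpredB // hreal.
rewrite !trB even_r subn1 /=; split.
  rewrite -lerBrDl; apply: (@sum0_max_ge _ _ _ _ l) => // i.
    by rewrite lerD2r -lminE ge_lmin.
  by rewrite lerD2r le_lmax.
(* The lower end: even power sums do not see the sign, and the least of the
   numbers - x i is the one with the index of lmax. *)
rewrite lerBrDr -lerBrDl.
have pow_opp e : ~~ odd e -> \sum_i x i ^+ e = \sum_i (- x i) ^+ e.
  move=> even_e; apply: eq_bigr => i _.
  by rewrite exprNn -signr_odd (negPf even_e) mul1r.
rewrite !pow_opp //=; last by rewrite negbK.
apply: (@sum0_max_ge _ _ _ _ j) => //= [i||i|i].
- by rewrite rpredN.
- by rewrite sumrN sum_x oppr0.
- by rewrite lerN2 lerD2r -lmaxE le_lmax.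
- by rewrite opprB lerD2l lerN2 ge_lmin.
Qed.
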